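(* For all integers $m,t\ge 1$ there is a smallest positive integer $s_0$ such that $T(s_0+k,m,t)=T(s_0,m,t)+k$ for every integer $k\ge 0$. Hence for all $m,t\ge 1$ the seed number $S(m,t)=s_0$ exists.
   Context: For positive integers $n,m,t$, $T(n,m,t)$ denotes the least number that is the sum of $n$ positive $m$th powers (i.e. $\sum_{i=1}^n a_i^m$ with all $a_i$ positive integers) in at least $t$ ways, provided such a number exists. Two ways are regarded as different if they differ as multisets of terms (order is irrelevant). An equality involving $T$ asserts in particular that the values of $T$ appearing in it exist. The seed number $S(m,t)$ is the smallest positive integer $s_0$ such that $T(n+1,m,t)=T(n,m,t)+1$ for all $n\ge s_0$; equivalently, such that $T(s_0+k,m,t)=T(s_0,m,t)+k$ for all $k\ge 0$. *)

(* Defs.v *)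
From mathcomp Require Import all_boot.
From mathcomp Require Import finmap multiset.

Set Implicit Arguments.
Unset Strict Implicit.
Unset Printing Implicit Defensive.

Local Open Scope fset_scope.
Local Open Scope mset_scope.
Local Open Scope nat_scope.

(* [size A] and the sum range over [enum_mset A], which lists each element
   with its multiplicity. *)
Definition is_way (n m N : nat) (A : {mset nat}) : Prop :=
  [/\ size A = n, {in A, forall a, 0 < a} & \sum_(a <- A) a ^ m = N].

Definition at_least_ways (n m t N : nat) : Prop :=
  exists W : {fset {mset nat}},
    t <= #|` W| /\ (forall A, A \in W -> is_way n m N A).

Definition is_least (P : nat -> Prop) (v : nat) : Prop :=
  P v /\ (forall w, P w -> v <= w).

(* T is a partial function, given by its graph: [is_T n m t v] says that
   T(n,m,t) exists and equals v. *)
Definition is_T (n m t v : nat) : Prop := is_least (at_least_ways n m t) v.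

(* T(n',m,t) = T(n,m,t) + k, both values existing *)
Definition T_eq_add (m t n' n k : nat) : Prop :=
  exists v, is_T n m t v /\ is_T n' m t (v + k).

(* S(m,t) exists and equals s *)
Definition is_seed (m t s : nat) : Prop :=
  is_least (fun s0 => 0 < s0 /\ (forall n, s0 <= n -> T_eq_add m t n.+1 n 1)) s.

(* Main.v *)
Require Import Defs.
From mathcomp Require Import all_boot.
From mathcomp Require Import finmap multiset zify.
From Stdlib Require Import Classical Wf_nat.

(** Appending the term [1] turns a way of writing [N] with [n] terms into a way
    of writing [N.+1] with [n.+1] terms, and distinct ways stay distinct
    ([at_least_ways_succ]).  Hence, from the first [n] for which T(n,m,t) exists,
    it exists for every larger [n] and T(n,m,t) - n never increases
    ([is_T_add]).  A nonincreasing sequence of natural numbers attains its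
    minimum and is constant from there on, which is the stabilization sought.

    It remains to find a single [n] for which T(n,m,t) exists.  The parts 1, 2
    and 3 suffice: [a] ones, [b] twos and [c] threes have a fixed number of terms
    and a fixed sum of m-th powers along any arithmetic progression of (a, b, c)
    with difference orthogonal to (1, 1, 1) and (1, 2^m, 3^m), for instance
    their cross product (3^m - 2^m, - (3^m - 1), 2^m - 1)
    ([at_least_ways_base]). *)

Set Implicit Arguments.
Unset Strict Implicit.
Unset Printing Implicit Defensive.

Local Open Scope fset_scope.
Local Open Scope mset_scope.
Local Open Scope nat_scope.

(** * Least elements *)

Lemma is_least_exists (P : nat -> Prop) :
  (exists n, P n) -> exists v, is_least P v.
Proof.
move=> exP.
have [v [[Pv minv] _]] :=
  dec_inh_nat_subset_has_unique_least_element P (fun n => classic (P n)) exP.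
by exists v; split=> // w /minv /leP.
Qed.

Lemma is_least_unique (P : nat -> Prop) v w :
  is_least P v -> is_least P w -> v = w.
Proof.
by move=> [Pv minv] [Pw minw]; apply/eqP; rewrite eqn_leq minv ?minw.
Qed.

Lemma is_least_iff (P Q : nat -> Prop) v :
  (forall n, P n <-> Q n) -> is_least P v -> is_least Q v.
Proof. by move=> PQ [/PQ Qv minv]; split=> // w /PQ /minv. Qed.

(** * Ways of writing a number as a sum of powers *)

Lemma is_way_seq_mset n m N (s : seq nat) :
  size s = n -> all (leq 1) s -> \sum_(a <- s) a ^ m = N ->
  is_way n m N (seq_mset s).
Proof.
move=> sz_s s_gt0 sum_s; have perm_s := perm_eq_seq_mset s; split.
- by rewrite (perm_size perm_s).
- by move=> a; rewrite (perm_mem perm_s) => /(allP s_gt0).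
- by rewrite (perm_big _ perm_s).
Qed.

Lemma at_least_ways_imfset (K : choiceType) n m t N (f : K -> {mset nat})
    (D : {fset K}) :
  injective f -> t <= #|` D| -> (forall x, x \in D -> is_way n m N (f x)) ->
  at_least_ways n m t N.
Proof.
move=> f_inj le_tD wayf; exists [fset f x | x in D]; split.
  by rewrite card_imfset.
by move=> A /imfsetP [x /= xD ->]; apply: wayf.
Qed.

Lemma at_least_ways_succ n m t N :
  at_least_ways n m t N -> at_least_ways n.+1 m t N.+1.
Proof.
move=> [W [le_tW wayW]].
apply: (@at_least_ways_imfset _ _ _ _ _ (fun A : {mset nat} => seq_mset (1 :: A)) W) => //.
  move=> A B /eq_seq_msetP; rewrite perm_cons => /eq_seq_msetP.
  by rewrite !seq_mset_id.
move=> A /wayW [sz_A A_gt0 sum_A]; apply: is_way_seq_mset => /=.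
- by rewrite sz_A.
- by apply/allP.
- by rewrite big_cons exp1n sum_A.
Qed.

(** This bound makes [v - n] an honest difference when [v] is T(n,m,t), so that
    minimizing it is meaningful. *)
Lemma at_least_ways_geq n m t N :
  0 < t -> at_least_ways n m t N -> n <= N.
Proof.
move=> t_gt0 [W [le_tW wayW]].
have := leq_trans t_gt0 le_tW.
rewrite cardfs_gt0 => /fset0Pn [A /wayW [<- A_gt0 <-]].
rewrite -sum1_size big_seq [leqRHS]big_seq.
by apply: leq_sum => a aA; rewrite expn_gt0 A_gt0.
Qed.

(** All terms equal to 2 give one way; the number of terms is chosen so that
    [t - 1] steps along the cross product still leave nonnegative counts. *)
Lemma at_least_ways_base m t :
  0 < m -> exists N, at_least_ways (t * (3 ^ m - 1)) m t N.
Proof.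
move=> m_gt0; exists (t * (3 ^ m - 1) * 2 ^ m).
have lt1_2m : 1 < 2 ^ m by rewrite -{1}(exp1n m) ltn_exp2r.
have lt_2m_3m : 2 ^ m < 3 ^ m by rewrite ltn_exp2r.
(* [s j] is reached from [t * (3 ^ m - 1)] twos in [j] steps; its number of
   twos determines [j]. *)
pose s (j : 'I_t) := nseq (j * (3 ^ m - 2 ^ m)) 1
  ++ nseq ((t - j) * (3 ^ m - 1)) 2 ++ nseq (j * (2 ^ m - 1)) 3.
apply: (@at_least_ways_imfset _ _ _ _ _ (fun j => seq_mset (s j))
          [fset j | j in 'I_t]).
- move=> i j /eq_seq_msetP /permP /(_ (pred1 2)).
  rewrite !count_cat !count_nseq /= !mul0n !mul1n !addn0 => /eqP.
  rewrite eqn_pmul2r; last by lia.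
  by move=> /eqP eq_ij; apply: val_inj => /=; move: (ltn_ord i) (ltn_ord j); lia.
- by rewrite card_imfset //= -cardE card_ord.
move=> j _; have lt_jt := ltn_ord j; apply: is_way_seq_mset.
- by rewrite !size_cat !size_nseq; nia.
- by rewrite !all_cat !all_nseq /= !orbT.
- rewrite !big_cat !big_nseq !iter_addn_0 exp1n.
  move: (nat_of_ord j) lt_jt => i lt_it.
  have [k ->] : exists k, t = i + k by exists (t - i); lia.
  move: lt1_2m lt_2m_3m; move: (2 ^ m) (3 ^ m) => u v lt1u lt_uv.
  have [p def_u] : exists p, u = p.+1 by exists u.-1; lia.
  have [q ->] : exists q, v = (p + q).+1 by exists (v - p.+1); lia.
  rewrite def_u subSS !subn1 /= !addKn; nia.
Qed.

(** * Growth of T *)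

Lemma is_T_add n m t v k :
  is_T n m t v -> exists w, is_T (n + k) m t w /\ w <= v + k.
Proof.
move=> [way_v _].
have ways k' : at_least_ways (n + k') m t (v + k').
  elim: k' => [|k' IHk]; first by rewrite !addn0.
  by rewrite !addnS; apply: at_least_ways_succ.
have [w Tw] := is_least_exists (ex_intro _ _ (ways k)).
by exists w; split=> //; exact: (proj2 Tw _ (ways k)).
Qed.

Lemma T_eq_add_stepwise m t s :
  (forall k, T_eq_add m t (s + k) s k) <->
  (forall n, s <= n -> T_eq_add m t n.+1 n 1).
Proof.
split=> [Ts n le_sn | Tstep].
  have [v [Tv Tvn]] := Ts (n - s); have [w [Tw Twn]] := Ts (n - s).+1.
  rewrite subnKC // in Tvn.
  rewrite addnS subnKC // (is_least_unique Tw Tv) in Twn.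
  by exists (v + (n - s)); rewrite addn1 -addnS.
elim=> [|k [v [Tv Tvk]]].
  by have [v [Tv _]] := Tstep s (leqnn s); exists v; rewrite !addn0.
have [w [Tw Tw1]] := Tstep _ (leq_addr k s).
exists v; split=> //.
by rewrite !addnS -[(v + k).+1]addn1 -(is_least_unique Tw Tvk).
Qed.

(** A point where T(n,m,t) - n is minimal is a point of stabilization. *)
Lemma T_eventually_affine m t :
  0 < m -> 0 < t -> exists s, 0 < s /\ forall k, T_eq_add m t (s + k) s k.
Proof.
move=> m_gt0 t_gt0.
pose excess e := exists n, 0 < n /\ is_T n m t (n + e).
have exT n v : 0 < n -> is_T n m t v -> excess (v - n).
  move=> n_gt0 Tv; exists n; split=> //.
  by rewrite subnKC // (at_least_ways_geq t_gt0 (proj1 Tv)).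
have [N /(ex_intro _ N) /is_least_exists [v Tv]] := at_least_ways_base t m_gt0.
have n_gt0 : 0 < t * (3 ^ m - 1).
  by rewrite muln_gt0 t_gt0 subn_gt0 -{1}(exp1n m) ltn_exp2r.
have [e [[s [s_gt0 Ts]] min_e]] :=
  is_least_exists (ex_intro _ _ (exT _ _ n_gt0 Tv)).
exists s; split=> // k; exists (s + e); split=> //.
have [w [Tw le_w]] := is_T_add k Ts.
have le_ew := min_e _ (exT _ _ (ltn_addr k s_gt0) Tw).
have le_skw := at_least_ways_geq t_gt0 (proj1 Tw).
by have <- : w = s + e + k by lia.
Qed.

Theorem theorem2p2 (m t : nat) (m_gt0 : 0 < m) (t_gt0 : 0 < t) :
  exists s0 : nat,
    is_least (fun s => 0 < s /\ (forall k, T_eq_add m t (s + k) s k)) s0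
    /\ is_seed m t s0.
Proof.
have [s0 least_s0] := is_least_exists (T_eventually_affine m_gt0 t_gt0).
exists s0; split=> //; apply: is_least_iff least_s0 => s.
by split=> -[s_gt0 /T_eq_add_stepwise Ts].
Qed.
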